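(* For every integer $h_0 \geq 2$, both of the following hold. (i) There exists a strictly decreasing sequence $(A_q)_{q=1}^{\infty}$ of sets of integers such that $\{1,\ldots,h_0-1\} \subseteq \mathcal{H}(A_q)$ but $h_0 \notin \mathcal{H}(A_q)$. (ii) There exists a strictly decreasing sequence $(A_q)_{q=1}^{\infty}$ of sets of integers such that $\{1,h_0\} \subseteq \mathcal{H}(A_q)$ but $\{2,3,\ldots,h_0-1\} \cap \mathcal{H}(A_q) = \emptyset$.
   Context: $\mathbf{N} = \{1,2,3,\ldots\}$ is the set of positive integers. For a set $A$ of integers and $h \in \mathbf{N}$, the $h$-fold sumset $hA$ is the set of all sums $a_1+\cdots+a_h$ of $h$ not necessarily distinct elements of $A$ (so $h\emptyset = \emptyset$). A sequence of sets $(A_q)_{q=1}^{\infty}$ is strictly decreasing if $A_{q+1} \subseteq A_q$ and $A_{q+1} \neq A_q$ for all $q \in \mathbf{N}$. For a strictly decreasing sequence $(A_q)_{q=1}^{\infty}$ of sets of integers, let $A = \bigcap_{q=1}^{\infty} A_q$ and define $\mathcal{H}(A_q) = \{h \in \mathbf{N} : hA = \bigcap_{q=1}^{\infty} hA_q\}$; this set depends on the whole sequence. For $h_0 = 2$ the set $\{2,3,\ldots,h_0-1\}$ is empty. *)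

(* Defs.v *)
From mathcomp Require Export all_boot all_order all_algebra.
From mathcomp Require Export classical_sets.

Set Implicit Arguments.
Unset Strict Implicit.
Unset Printing Implicit Defensive.

Import GRing.Theory.

Local Open Scope classical_set_scope.
Local Open Scope ring_scope.

Definition posnat : set nat := [set n | (0 < n)%N].

Definition sumset (h : nat) (A : set int) : set int :=
  [set s | exists a : 'I_h -> int,
     (forall i, A (a i)) /\ s = \sum_(i < h) a i].

(* Sequences are indexed by the positive integers: the value [A 0] is never
   used below. *)
Definition strictly_decreasing (A : nat -> set int) : Prop :=
  forall q, posnat q -> A q.+1 `<=` A q /\ A q.+1 <> A q.

Definition calH (A : nat -> set int) : set nat :=
  [set h | posnat h /\
     sumset h (\bigcap_(q in posnat) A q) =
     \bigcap_(q in posnat) sumset h (A q)].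

(* Main.v *)
Require Import Defs.
From mathcomp Require Import zify.

Set Implicit Arguments.
Unset Strict Implicit.
Unset Printing Implicit Defensive.

Import Order.TTheory GRing.Theory Num.Theory.

Local Open Scope ring_scope.
Local Open Scope classical_set_scope.

(** Both sequences come from congruences.

    For (i), let M = h0 + 1 and let A_q consist of the multiples of M ^ q that
    are 1 modulo h0.  Every sum of elements of A_q is a multiple of M ^ q, so 0
    is the only integer that can lie in all the h A_q
    ([eq0_of_dvdz_expn]); and a sum of h elements is h modulo h0, so 0 is not
    one of them when 0 < h < h0.  Hence the intersection of the h A_q is empty
    for these h, and they belong to H(A_q).  On the other hand M ^ q is itself
    1 modulo h0, and so is - (h0 - 1) M ^ q; these add up to 0 in h0 A_q for
    every q, whereas the intersection of the A_q is empty since it could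
    contain only 0.

    For (ii), let m = h0 + 1 and let S be the set of integers that are 0 or 1
    modulo m.  The sumset h S consists of the classes 0, ..., h
    ([sumset_mod01], [sumset_mod01_le]), so h0 is the least h for which h S is
    all of Z.  Let A_q be S together with all integers of absolute value at
    least m q, so that the intersection of the A_q is S.  Any integer is a sum
    of two, hence of any h >= 2, integers of large absolute value
    ([sumset_far]), so that the intersection of the h A_q is Z for h >= 2.
    Therefore h >= 2 belongs to H(A_q) exactly when h S = Z. *)

Lemma sumset_cons h (A : set int) x s :
  A x -> sumset h A s -> sumset h.+1 A (x + s).
Proof.
move=> Ax [a [Aa ->]]; exists (fun i => oapp a x (unlift ord0 i)); split.
  by move=> i; case: unliftP => [j _|_] /=.
rewrite big_ord_recl unlift_none /=; congr (_ + _).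
by apply: eq_bigr => i _; rewrite liftK.
Qed.

Lemma sumset1 (A : set int) : sumset 1 A = A.
Proof.
apply/seteqP; split => [s [a [Aa ->]]|x Ax]; first by rewrite big_ord1.
by exists (fun=> x); rewrite big_ord1.
Qed.

Lemma sumset_nseq h (A : set int) x : A x -> sumset h A (x *+ h).
Proof. by move=> Ax; exists (fun=> x); rewrite sumr_const card_ord. Qed.

Lemma sumsetS h (A B : set int) : A `<=` B -> sumset h A `<=` sumset h B.
Proof. by move=> AB s [a [Aa ->]]; exists a; split=> // i; apply: AB. Qed.

(** The inclusion of h A in the intersection of the h A_q always holds, so only
    the other one has to be checked. *)
Lemma calH_sub (A : nat -> set int) h : (0 < h)%N ->
  \bigcap_(q in posnat) sumset h (A q) `<=`
    sumset h (\bigcap_(q in posnat) A q) ->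
  calH A h.
Proof.
move=> h_gt0 sub; split=> //; apply/seteqP; split=> // s hs q q_gt0.
by apply: sumsetS hs; apply: bigcap_inf.
Qed.

Lemma calH1 (A : nat -> set int) : calH A 1.
Proof.
apply: calH_sub => // s; rewrite sumset1 => As q q_gt0.
by have := As q q_gt0; rewrite sumset1.
Qed.

Definition pow_mod1 (n q : nat) : set int :=
  [set x | (x = 1 %[mod n])%Z /\ ((n.+1 ^ q)%N %| x)%Z].

Lemma expS_mod1 n q : ((n.+1 ^ q)%N = 1 %[mod n])%Z.
Proof. by rewrite !modz_nat -addn1 -modnXm modnDl modnXm exp1n. Qed.

Lemma pow_mod1_gen n q : pow_mod1 n q (n.+1 ^ q)%N.
Proof. by split; [exact: expS_mod1 | exact: dvdzz]. Qed.

Lemma eq0_of_dvdz_expn (M : nat) (x : int) : (1 < M)%N ->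
  (forall q, posnat q -> ((M ^ q)%N %| x)%Z) -> x = 0.
Proof.
move=> M_gt1 /(_ `|x|.+1 isT); apply: contraPeq => x_neq0.
rewrite dvdzE /= => /dvdn_leq; rewrite absz_gt0 => /(_ x_neq0).
by have := ltn_expl `|x|.+1 M_gt1; lia.
Qed.

Lemma bigcap_pow_mod1 n : (1 < n)%N ->
  \bigcap_(q in posnat) pow_mod1 n q = set0.
Proof.
move=> n_gt1; apply/seteqP; split=> // x Ax.
have x0 : x = 0 by apply: (@eq0_of_dvdz_expn n.+1) => [|q /Ax[]//]; lia.
have [+ _] := Ax 1%N isT; rewrite x0 => /esym/eqP.
by rewrite eqz_mod_dvd subr0 dvdzE dvdn1 /=; lia.
Qed.

Lemma sumset_pow_mod1_mod n q h s :
  sumset h (pow_mod1 n q) s -> (s = h%:Z %[mod n])%Z.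
Proof.
case=> a [Aa ->]; apply/eqP; rewrite eqz_mod_dvd.
have -> : h%:Z = \sum_(i < h) 1 by rewrite sumr_const card_ord pmulrn intz.
rewrite -sumrB; apply: rpred_sum => i _.
by rewrite -eqz_mod_dvd; apply/eqP; case: (Aa i).
Qed.

Lemma sumset_pow_mod1_dvd n q h s :
  sumset h (pow_mod1 n q) s -> ((n.+1 ^ q)%N %| s)%Z.
Proof. by case=> a [Aa ->]; apply: rpred_sum => i _; case: (Aa i). Qed.

(** n copies of the power x = n.+2 ^ q are cancelled by the single element
    - n x, which is again 1 modulo n.+1 because - n and x are. *)
Lemma sumset_pow_mod1_0 n q : sumset n.+1 (pow_mod1 n.+1 q) 0.
Proof.
set x : int := (n.+2 ^ q)%N.
have Ax : pow_mod1 n.+1 q x by exact: pow_mod1_gen.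
rewrite -(addNr (x *+ n)); apply: sumset_cons; last exact: sumset_nseq.
have [x1 dx] := Ax; split; last by rewrite rpredN rpredMn.
rewrite -x1; apply/eqP; rewrite eqz_mod_dvd -opprD rpredN -mulrSr.
by rewrite -mulr_natr natz dvdz_mull.
Qed.

Lemma pow_mod1_decreasing n : (0 < n)%N -> strictly_decreasing (pow_mod1 n).
Proof.
move=> n_gt0 q _; split=> [x [x1 dx]|eqA].
  by split=> //; apply: dvdz_trans dx; rewrite dvdzE /= dvdn_exp2l.
have := pow_mod1_gen n q; rewrite -eqA => -[_].
by rewrite dvdzE /= dvdn_Pexp2l ?ltnn.
Qed.

Definition mod01 (m : nat) : set int := [set x | (x %% m)%Z <= 1].

(** A nonzero residue is lowered by taking off a summand 1; once it is 0, all
    the remaining summands but one can be taken to be 0. *)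
Lemma sumset_mod01 m h (s : int) : (1 < m)%N ->
  (s %% m)%Z <= h.+1%:Z -> sumset h.+1 (mod01 m) s.
Proof.
move=> m_gt1; elim: h s => [|h IHh] s sh; first by rewrite sumset1.
have [s0|s_neq0] := eqVneq (s %% m)%Z 0.
  rewrite -[s]add0r; apply: sumset_cons; first by rewrite /mod01 /= mod0z.
  by apply: IHh; rewrite s0.
rewrite -(subrKC 1 s); apply: sumset_cons.
  by rewrite /mod01 /= modz_small; lia.
apply: IHh.
have s_ge0 : 0 <= (s %% m)%Z by apply: modz_ge0; lia.
have s_lt : (s %% m)%Z < m by apply: ltz_pmod; lia.
by rewrite -modzDml modz_small; lia.
Qed.

(** Taking the least residue modulo m is subadditive. *)
Lemma sumset_mod01_le m h s : (0 < m)%N ->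
  sumset h (mod01 m) s -> (s %% m)%Z <= h%:Z.
Proof.
move=> m_gt0 [a [Sa ->]].
have -> : h%:Z = \sum_(i < h) 1 by rewrite sumr_const card_ord pmulrn intz.
apply: (big_ind2 (fun x y : int => (x %% m)%Z <= y)) => [||i _].
- by rewrite mod0z.
- move=> x1 y1 x2 y2 le1 le2; apply: le_trans (lerD le1 le2).
  rewrite -modzDm; set z := _ + _.
  have z_ge0 : 0 <= z by rewrite addr_ge0 ?modz_ge0; lia.
  by rewrite {2}(divz_eq z m) lerDr mulr_ge0 ?divz_ge0.
- exact: Sa.
Qed.

Definition mod01_far (m q : nat) : set int :=
  mod01 m `|` [set x | (m * q <= `|x|)%N].

(** Already two summands of absolute value at least N suffice: |s| + N and
    s - |s| - N. *)
Lemma sumset_far h (N : nat) (A : set int) s :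
  [set x : int | (N <= `|x|)%N] `<=` A -> sumset h.+2 A s.
Proof.
move=> NA; elim: h s => [|h IHh] s.
  have -> : s = (`|s|%N + N)%N%:Z + (s - (`|s|%N + N)%N%:Z) by lia.
  by apply: sumset_cons; rewrite ?sumset1; apply: NA => /=; lia.
rewrite -(subrKC N%:Z s); apply: sumset_cons; last exact: IHh.
by apply: NA => /=.
Qed.

Lemma bigcap_mod01_far m : (0 < m)%N ->
  \bigcap_(q in posnat) mod01_far m q = mod01 m.
Proof.
move=> m_gt0; apply/seteqP; split=> [x Ax|x Sx q _]; last by left.
have [//|/=] := Ax `|x|.+1 isT; nia.
Qed.

Lemma mod01_far_decreasing m : (2 < m)%N -> strictly_decreasing (mod01_far m).
Proof.
move=> m_gt2 q _; split=> [x [Sx|/= qx]|eqA]; [by left|by right=> /=; nia|].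
(* 2 is the least residue excluded from mod01 m. *)
have : mod01_far m q (m * q + 2)%N by right=> /=; lia.
rewrite -eqA => -[|/=]; last by nia.
by rewrite /mod01 /= modz_nat mulnC modnMDl modn_small.
Qed.

(** For h >= 2 every h A_q is Z, so membership of h says that the classes 0 and
    1 modulo m have an h-fold sumset equal to Z; the number that decides this
    is m - 1, whose residue is the largest. *)
Lemma calH_mod01_far m h : (0 < m)%N ->
  calH (mod01_far m) h.+2 <-> (m <= h.+3)%N.
Proof.
move=> m_gt0; split=> [[_]|m_le].
  rewrite bigcap_mod01_far // => eqH.
  have : sumset h.+2 (mod01 m) m.-1.
    by rewrite eqH => q _; apply: (@sumset_far _ (m * q)); right.
  by move/(sumset_mod01_le m_gt0); rewrite modz_nat modn_small; lia.
apply: calH_sub => // s _; rewrite bigcap_mod01_far //.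
have [m_gt1|m_le1] := ltnP 1 m.
  by apply: sumset_mod01 => //; have := ltz_pmod s (d := m); lia.
apply: (@sumset_far _ 0) => x _; rewrite /mod01 /=.
by have := ltz_pmod x (d := m); lia.
Qed.

Theorem corollary2 (h0 : nat) (h0_ge2 : (2 <= h0)%N) :
  (exists A : nat -> set int,
     [/\ strictly_decreasing A,
         [set h : nat | (1 <= h <= h0 - 1)%N] `<=` calH A
       & ~ calH A h0])
  /\
  (exists A : nat -> set int,
     [/\ strictly_decreasing A,
         [set 1%N; h0] `<=` calH A
       & [set h : nat | (2 <= h <= h0 - 1)%N] `&` calH A = set0]).
Proof.
split.
  exists (pow_mod1 h0); split; first by apply: pow_mod1_decreasing; lia.
    move=> h /= h_lt; apply: calH_sub => [|s hs]; first by lia.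
    have s0 : s = 0.
      apply: (@eq0_of_dvdz_expn h0.+1) => [|q /hs/sumset_pow_mod1_dvd//].
      by lia.
    have := sumset_pow_mod1_mod (hs 1%N isT).
    by rewrite s0 !modz_nat mod0n modn_small; lia.
  case=> _; rewrite bigcap_pow_mod1 // => eqH.
  have : sumset h0 set0 0.
    by rewrite eqH => q _; case: h0 h0_ge2 {eqH} => // n _;
      exact: sumset_pow_mod1_0.
  by case=> a [/(_ (Ordinal (ltnW h0_ge2)))].
exists (mod01_far h0.+1); split; first by apply: mod01_far_decreasing; lia.
  move=> h [->|->]; first exact: calH1.
  by case: h0 h0_ge2 => [|[|n]] // _; apply/calH_mod01_far.
apply/seteqP; split=> // h [/= h_lt].
by case: h h_lt => [|[|h]] // h_lt /calH_mod01_far; lia.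
Qed.
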